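(* Let $n\ge 3$ be an integer, $0<m<\frac{n-2}{n}$, $\eta>0$, and let $\alpha,\beta\in\mathbb{R}$ satisfy $$\frac{2\beta}{1-m}>\max(\alpha,0).$$ Let $v$ be the radially symmetric solution of $$\frac{n-1}{m}\Delta v^m+\alpha v+\beta x\cdot\nabla v=0,\quad v>0,\quad\text{in }\mathbb{R}^n,\qquad v(0)=\eta.$$ Then there exists a constant $A>0$ such that $$\lim_{|x|\to\infty}|x|^{\alpha/\beta}v(x)=A.$$
   Context: Solutions are classical positive solutions on $\mathbb{R}^n$; radially symmetric means $v(x)$ depends only on $|x|$. Under the stated hypotheses the radially symmetric solution exists and is unique. *)

(* Defs.v *)
From mathcomp Require Import all_boot all_order all_algebra.
From mathcomp Require Import all_classical all_reals all_analysis.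

Set Implicit Arguments.
Unset Strict Implicit.
Unset Printing Implicit Defensive.
Import Order.TTheory GRing.Theory Num.Theory.
Import numFieldNormedType.Exports.

Local Open Scope classical_set_scope.
Local Open Scope ring_scope.

Section Euclidean.
Context {R : realType} {n : nat}.
Implicit Types (x y : 'rV[R]_n) (f g : 'rV[R]_n -> R).

Definition dot x y : R := \sum_(i < n) x 0 i * y 0 i.

(* The library norm `|x| on 'rV[R]_n is the sup norm, so the Euclidean norm is
   introduced separately; both induce the same topology and derivatives. *)
Definition enorm x : R := Num.sqrt (dot x x).

Definition radial f := forall x y, enorm x = enorm y -> f x = f y.

Definition partial (i : 'I_n) f : 'rV[R]_n -> R :=
  fun x => 'D_(delta_mx 0 i) f x.

Definition grad f x : 'rV[R]_n := \row_(i < n) partial i f x.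

Definition laplacian f x : R := \sum_(i < n) partial i (partial i f) x.

Fixpoint class_C (k : nat) f : Prop :=
  if k is k'.+1 then
    continuous f /\
    forall i : 'I_n,
      (forall x, derivable f x (delta_mx 0 i)) /\ class_C k' (partial i f)
  else continuous f.

Definition infty_nbhs : set_system 'rV[R]_n :=
  fun P => exists M : R, forall x, M < enorm x -> P x.

Global Instance infty_nbhs_filter : Filter infty_nbhs.
Proof.
split; first by exists 0.
- move=> P Q [M1 h1] [M2 h2]; exists (Num.max M1 M2) => x.
  by rewrite gt_max => /andP[/h1 Px /h2 Qx].
- by move=> P Q PQ [M h]; exists M => x /h /PQ.
Qed.

(* Since v is positive and C^2, so is v^m: the Laplacian below involves only
   derivatives that exist. *)
Definition classical_positive_solution (m alpha beta : R) (v : 'rV[R]_n -> R) :=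
  [/\ class_C 2 v,
      forall x, 0 < v x &
      forall x, (n%:R - 1) / m * laplacian (fun y => v y `^ m) x
                + alpha * v x + beta * dot x (grad v x) = 0].

End Euclidean.

Arguments infty_nbhs R n : clear implicits.

Global Instance infty_nbhs_proper {R : realType} {n : nat} :
  ProperFilter (infty_nbhs R n.+1).
Proof.
split; last exact: infty_nbhs_filter.
move=> [M /(_ ((`|M| + 1) *: delta_mx 0 0))]; apply.
rewrite /enorm /dot big_ord_recl big1 => [|i _]; last first.
  by rewrite !mxE /= !mulr0.
rewrite !mxE /= mulr1 addr0 -expr2 sqrtr_sqr ger0_norm ?addr_ge0//.
by rewrite (le_lt_trans (ler_norm M))// ltrDl.
Qed.

(* Main.v *)
Require Import Defs.
From mathcomp Require Import all_boot all_order all_algebra.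
From mathcomp Require Import all_classical all_reals all_analysis.
From mathcomp Require Import ring lra.

Set Implicit Arguments.
Unset Strict Implicit.
Unset Printing Implicit Defensive.
Import Order.TTheory GRing.Theory Num.Theory.
Import numFieldNormedType.Exports.

Local Open Scope classical_set_scope.
Local Open Scope ring_scope.

(** Write [v x = phi |x|], [k = alpha / beta] and pass to the logarithmic
variable [s = ln |x|]. With [u s = ln (phi (e^s))], [z = u'] and the weight
[W s = e^(2 s + (1 - m) u s)], which is [|x|^2 v^(1-m)], the equation becomes
the planar system

  [u' = z],   [z' = - z (n - 2 + m z) - b W (z + k)],   [b = beta / (n - 1)],

with [z] tending to [0] at [-oo] because [phi] is smooth at the origin. The
claim is that [k s + u s] converges to a finite limit at [+oo].

Constant slopes are barriers for this system. If [K >= max k 0] and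
[0 < m K < n - 2] then [z' > 0] whenever [z = - K]; if [K >= - k] and [K > 0]
then [z' < 0] whenever [z = K]. Hence [z] stays in a bounded interval whose
lower end [- K] may be any number with [max k 0 < K < 2 / (1 - m)]. Such a [K]
exists exactly because [2 beta / (1 - m) > max alpha 0], and it does satisfy
[m K < n - 2] because [m < (n - 2) / n] ([slope_gt], [slope_lt]). Integrating
[z > - K] gives [u >= u 0 - K s], so [W] grows at least like [e^(e s)] with
[e = 2 - K (1 - m) > 0] ([weight_ge]).

When [W] is large the system forces [z] towards [- k], but this need not be
quantified: the corrected quantity [G = k s + u + ln (b + z / W)] satisfies
[G' = (k - n) z / (b W + z)] exactly. The right-hand side is [O(e^(- e s))], so
[G] converges; since [z / W] tends to [0], so does [k s + u]
([log_flow_cvg]).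

Passing from the partial differential equation to the ordinary one only uses
one-variable calculus: for [i <> 0] the function [v^m] along the line
[r e_0 + t e_i] is the radial profile at [sqrt (r^2 + t^2)], and its second
derivative in [t] at [0] is the profile derivative divided by [r]
([laplacian_radial]). *)

(** * Real functions controlled by their derivative *)

(** At the first zero after [a] the function comes down from positive values,
which a positive derivative there forbids. *)
Lemma barrier_gt0 (R : realType) (f df : R -> R) (a : R) :
  (forall s : R, is_derive s 1 f (df s)) ->
  (forall s, s <= a -> 0 < f s) ->
  (forall s, f s = 0 -> 0 < df s) ->
  forall s, 0 < f s.
Proof.
move=> fd fa f0 t; rewrite ltNge; apply/negP => ft.
pose S := [set s | f s <= 0].
have St : S t by [].
have lbS : lbound S a.
  by move=> s /= fs; rewrite leNgt; apply/negP => /ltW/fa; rewrite ltNge fs.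
have infS : has_inf S by split; [exists t | exists a].
pose c := inf S.
have cS s : s < c -> 0 < f s.
  move=> sc; rewrite ltNge; apply/negP => fs.
  by move: sc; rewrite ltNge (inf_lbound infS.2).
have /is_derive1_caratheodory [g [fg gc gd]] := fd c.
have fc : {for c, continuous f}.
  by apply: differentiable_continuous; apply/derivable1_diffP; apply: ex_derive.
have [fc0|fc0|fc0] := ltgtP (f c) 0.
- have /nbhs_ballP[e /= e0 he] : \forall s \near c, f s < 0.
    exact: (cvgr_lt (f c) fc).
  have /he/ltW : ball c e (c - e / 2).
    by rewrite /ball /= opprB addrCA subrr addr0 gtr0_norm ?ltr_pdivrMr; lra.
  by rewrite leNgt cS//; lra.
- have /nbhs_ballP[e /= e0 he] : \forall s \near c, 0 < f s.
    exact: (cvgr_gt (f c) fc).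
  have [s fs sc] := inf_adherent e0 infS.
  have cs : c <= s by apply: inf_lbound => //; exact: infS.2.
  have /he : ball c e s.
    rewrite /ball /= distrC ger0_norm -/c ?subr_ge0//.
    by rewrite -/c in sc; lra.
  by rewrite ltNge fs.
(* The slope [g] of the secants through [c] is continuous and positive at [c],
   so [f] is negative just before its first zero. *)
- have dc := f0 _ fc0; rewrite -gd in dc.
  have /nbhs_ballP[e /= e0 he] : \forall s \near c, 0 < g s.
    exact: (cvgr_gt (g c) gc).
  have /he g0 : ball c e (c - e / 2).
    by rewrite /ball /= opprB addrCA subrr addr0 gtr0_norm ?ltr_pdivrMr; lra.
  have := fg (c - e / 2); rewrite fc0 subr0 addrAC subrr add0r => fE.
  have /cS : c - e / 2 < c by lra.
  by rewrite fE mulrN oppr_gt0 ltNge mulr_ge0//; lra.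
Qed.

Lemma derive_ge0_nondecreasing (R : realType) (f df : R -> R) (a : R) :
  (forall s : R, a <= s -> is_derive s 1 f (df s)) ->
  (forall s, a <= s -> 0 <= df s) ->
  forall x y, a <= x -> x <= y -> f x <= f y.
Proof.
move=> fd df0; apply: ger0_derive1_ndecry.
- by move=> s; rewrite in_itv /= andbT => /ltW/fd[].
- move=> s; rewrite in_itv /= andbT => /ltW as_.
  have fds := fd _ as_.
  by rewrite derive1E derive_val df0.
- apply: derivable_within_continuous => s; rewrite in_itv /= andbT => /fd[] //.
Qed.

Lemma cvg_expR_decay (R : realType) (e : R) : 0 < e ->
  expR (- (e * s)) @[s --> +oo] --> 0.
Proof.
move=> e0.
apply: (@cvg_comp _ _ _ (fun s : R => e * s) (fun s => expR (- s)) +oo +oo).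
  by apply: gt0_cvgMry => //; exact: cvg_id.
exact: cvgr_expR.
Qed.

Lemma is_derive_expR_lin (R : realType) (c s : R) :
  is_derive s 1 (fun t => expR (c * t)) (c * expR (c * s)).
Proof.
have dl : is_derive s 1 ( *%R c) c.
  apply: (is_derive_eq (is_deriveZ c (is_derive_id s 1))).
  by rewrite /GRing.scale /= mulr1.
apply: (is_derive_eq (is_derive1_comp (is_derive_expR (c * s)) dl)).
by rewrite mulrC.
Qed.

(** Adding or subtracting the tail [E s = C / e * expR (- e * s)] of the
dominating integral makes [g] monotone in either direction: [g - E] increases
and stays below the decreasing [g + E]. *)
Lemma cvg_of_integrable_derive (R : realType) (g dg : R -> R) (a C e : R) :
  0 < e ->
  (forall s : R, a <= s -> is_derive s 1 g (dg s)) ->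
  (forall s, a <= s -> `|dg s| <= C * expR (- (e * s))) ->
  exists l : R, g s @[s --> +oo] --> l.
Proof.
move=> e0 gd bnd.
pose E s := C / e * expR (- e * s).
have dE (s : R) : is_derive s 1 E (- (C * expR (- e * s))).
  apply: (is_derive_eq (is_deriveZ (C / e) (is_derive_expR_lin (- e) s))).
  by rewrite /GRing.scale /=; field; rewrite gt_eqF.
have bnd' s : a <= s -> - (C * expR (- e * s)) <= dg s <= C * expR (- e * s).
  by move=> /bnd; rewrite mulNr ler_norml.
have lo := @derive_ge0_nondecreasing R (g - E) _ a
  (fun s h => is_deriveB (gd s h) (dE s)).
have {}lo x y : a <= x -> x <= y -> g x - E x <= g y - E y.
  by apply: lo => s /bnd'/andP[]; lra.
have hi := @derive_ge0_nondecreasing R (- (g + E)) _ a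
  (fun s h => is_deriveN (is_deriveD (gd s h) (dE s))).
have {}hi x y : a <= x -> x <= y -> g y + E y <= g x + E x.
  move=> ax xy; rewrite -lerN2; apply: hi => // s /bnd'/andP[]; lra.
have C0 : 0 <= C.
  have := le_trans (normr_ge0 _) (bnd a (lexx a)).
  by rewrite pmulr_lge0 // expR_gt0.
have E0 s : 0 <= E s by rewrite mulr_ge0 ?expR_ge0// divr_ge0// ltW.
have EV : E s @[s --> +oo] --> 0.
  rewrite -(mulr0 (C / e)); apply: cvgMr.
  under eq_fun do rewrite mulNr.
  exact: cvg_expR_decay.
(* Freezing the function before [a] makes it monotone on the whole line. *)
pose h s := g (Num.max a s) - E (Num.max a s).
have hh : {homo h : x y / x <= y}.
  move=> x y xy; apply: lo; first by rewrite le_max lexx.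
  by rewrite ge_max !le_max lexx xy orbT.
have hb : has_ubound (range h).
  exists (g a + E a) => _ [s _ <-].
  have am : a <= Num.max a s by rewrite le_max lexx.
  by have := hi _ _ (lexx a) am; have := E0 (Num.max a s); rewrite /h; lra.
have hl := nondecreasing_cvgr hh hb.
exists (sup (range h) + 0).
apply: cvg_trans (cvgD hl EV).
apply: near_eq_cvg; exists a; split=> [|s /ltW as_]; first exact: num_real.
by rewrite -[LHS]/(h s + E s) /h max_r ?subrK.
Qed.

(** * The equation in the logarithmic variable *)

Section LogarithmicFlow.
Context {R : realType} (n m k b : R) (u z : R -> R).
Let W (s : R) := expR (2 * s + (1 - m) * u s).
Hypothesis du : forall s : R, is_derive s 1 u (z s).
Hypothesis dz : forall s : R, is_derive s 1 z
  (- z s * (n - 2 + m * z s) - b * W s * (z s + k)).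
Hypothesis z0 : z s @[s --> -oo] --> 0.
Hypotheses (m0 : 0 < m) (m1 : m < 1) (mn : m * n < n - 2) (b0 : 0 < b).

Let W_gt0 s : 0 < W s. Proof. exact: expR_gt0. Qed.

(** At [z = - K] the derivative [z'] equals
[K (n - 2 - m K) + b W (K - k)], which is positive. *)
Lemma slope_gt (K : R) : 0 < K -> k <= K -> m * K < n - 2 ->
  forall s, - K < z s.
Proof.
move=> K0 kK mK.
have [a ha] : exists a, forall s, s <= a -> 0 < z s + K.
  have : \forall s \near -oo, - K < z s by apply: (cvgr_gt 0 z0); lra.
  move=> [a [_ ha]]; exists (a - 1) => s sa; have /ha : s < a by lra.
  by lra.
have dzK (s : R) := is_deriveD (dz s) (is_derive_cst K s 1).
suff h s : 0 < z s + K by move=> s; have := h s; lra.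
apply: (barrier_gt0 dzK ha) => {}s /= zK.
have -> : z s = - K by have : z s + K = 0 := zK; lra.
rewrite addr0.
have -> : - - K * (n - 2 + m * - K) - b * W s * (- K + k)
  = K * (n - 2 - m * K) + b * W s * (K - k) by ring.
have A1 : 0 < K * (n - 2 - m * K) by rewrite mulr_gt0// subr_gt0.
have A2 : 0 <= b * W s * (K - k).
  by rewrite mulr_ge0 ?subr_ge0// mulr_ge0// ltW.
lra.
Qed.

(** At [z = K] the derivative [z'] equals
[- K (n - 2 + m K) - b W (K + k)], which is negative. *)
Lemma slope_lt (K : R) : 0 < K -> - k <= K -> forall s, z s < K.
Proof.
move: (m0) (m1) (mn) => m_gt0 m_lt1 mn_lt K0 kK.
have n2 : 0 < n - 2.
  rewrite ltNge; apply/negP => n2.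
  have : 0 <= (2 - n) * (1 - m) by rewrite mulr_ge0//; lra.
  by nra.
have [a ha] : exists a, forall s, s <= a -> 0 < K - z s.
  have : \forall s \near -oo, z s < K by apply: (cvgr_lt 0 z0); lra.
  move=> [a [_ ha]]; exists (a - 1) => s sa; have /ha : s < a by lra.
  by lra.
have dzK (s : R) := is_deriveB (is_derive_cst K s 1) (dz s).
suff h s : 0 < K - z s by move=> s; have := h s; lra.
apply: (barrier_gt0 dzK ha) => {}s /= zK.
have -> : z s = K by have : K - z s = 0 := zK; lra.
rewrite sub0r.
have -> : - (- K * (n - 2 + m * K) - b * W s * (K + k))
  = K * (n - 2 + m * K) + b * W s * (K + k) by ring.
have A1 : 0 < K * (n - 2 + m * K) by rewrite mulr_gt0// addr_gt0// mulr_gt0.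
have A2 : 0 <= b * W s * (K + k).
  by rewrite mulr_ge0 ?mulr_ge0 ?(ltW b0) ?(ltW (W_gt0 s))//; lra.
lra.
Qed.

(** The slope bound makes [u t + K t] nondecreasing, so that [u s] is at least
[u 0 - K s]; this is inserted in the exponent of [W]. *)
Lemma weight_ge (K s : R) : (forall s, - K < z s) -> 0 <= s ->
  expR ((1 - m) * u 0) * expR ((2 - K * (1 - m)) * s) <= W s.
Proof.
move: (m1) => m_lt1 zK s0.
have du' (t : R) : is_derive t 1 (fun t => u t + K * t) (z t + K).
  apply: (is_derive_eq (is_deriveD (du t) (is_deriveZ K (is_derive_id t 1)))).
  by rewrite /GRing.scale /= mulr1.
have := @derive_ge0_nondecreasing R _ _ 0 (fun t _ => du' t) _ 0 s (lexx 0) s0.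
rewrite mulr0 addr0 => /(_ _)/wrap[t _|h]; first by have := zK t; lra.
rewrite -expRD /W ler_expR; nra.
Qed.

(** The correction [ln (b + z / W)] is chosen so that in the derivative of
[k s + u + ln (b + z / W)] the terms without the factor [1 / W] cancel. What
remains is a bounded multiple of [z / W], hence exponentially small. *)
Lemma log_flow_cvg : k * (1 - m) < 2 ->
  exists l : R, k * s + u s @[s --> +oo] --> l.
Proof.
move: (m0) (m1) (mn) (b0) => m_gt0 m_lt1 mn_lt b_gt0 km.
(* Any [K] strictly between [max k 0] and [2 / (1 - m)] will do. *)
pose K := (Num.max k 0 + 2 / (1 - m)) / 2.
have m1' : 0 < 1 - m by lra.
have KM : Num.max k 0 < 2 / (1 - m).
  by rewrite ltr_pdivlMr// /Num.max; case: ifP; lra.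
have [k_le z_le] : k <= Num.max k 0 /\ 0 <= Num.max k 0.
  by rewrite !le_max !lexx orbT.
have K0 : 0 < K by rewrite /K; lra.
have kK : k <= K by rewrite /K; lra.
have K2 : K * (1 - m) < 2 by rewrite -ltr_pdivlMr// /K; lra.
have mK : m * K < n - 2 by nra.
pose e := 2 - K * (1 - m).
have e0 : 0 < e by rewrite /e; lra.
pose L := `|k| + 1.
have lo := slope_gt K0 kK mK.
have hi : forall s, z s < L.
  apply: slope_lt; rewrite /L ?ltr_wpDl//.
  by have := ler_norm (- k); rewrite normrN; lra.
pose M := K + L.
have zM s : `|z s| <= M.
  rewrite ler_norml /M; have := lo s; have := hi s; rewrite /L.
  by have := normr_ge0 k; lra.
have M0 : 0 <= M := le_trans (normr_ge0 _) (zM 0).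
pose c := expR ((1 - m) * u 0).
have c0 : 0 < c := expR_gt0 _.
have WE s : 0 <= s -> c * expR (e * s) <= W s := weight_ge lo.
have zW s : 0 <= s -> `|z s / W s| <= M / c * expR (- (e * s)).
  move=> s0; rewrite normrM normfV (gtr0_norm (W_gt0 s)) ler_pdivrMr//.
  have E0 : 0 < expR (e * s) := expR_gt0 _.
  apply: (le_trans (zM s)); rewrite expRN.
  have -> : M / c / expR (e * s) * W s = M * (W s / (c * expR (e * s))).
    by field; rewrite !gt_eqF.
  by rewrite ler_peMr// ler_pdivlMr ?mul1r ?WE// mulr_gt0.
have zW0 : z s / W s @[s --> +oo] --> 0.
  apply/norm_cvg0P.
  have E0 : M / c * expR (- (e * s)) @[s --> +oo] --> 0.
    rewrite -[X in _ --> X](mulr0 (M / c)); apply: cvgMr.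
    exact: cvg_expR_decay.
  apply: (squeeze_cvgr _ (cvg_cst 0) E0); near=> s.
  rewrite normr_ge0 /=; apply: zW.
  by near: s; apply: nbhs_pinfty_ge; exact: num_real.
have [a ha] : exists a, forall s, a <= s -> - (b / 2) < z s / W s.
  have : \forall s \near +oo, - (b / 2) < z s / W s.
    by apply: (cvgr_gt 0 zW0); lra.
  move=> [a [_ ha]]; exists (a + 1) => s sa; have /ha : a < s by lra.
  by lra.
have dW (s : R) : is_derive s 1 W ((2 + (1 - m) * z s) * W s).
  have dl : is_derive s 1 (fun t => 2 * t + (1 - m) * u t) (2 + (1 - m) * z s).
    apply: (is_derive_eq (is_deriveD (is_deriveZ 2 (is_derive_id s 1))
                                     (is_deriveZ (1 - m) (du s)))).
    by rewrite /GRing.scale /= mulr1.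
  apply: (is_derive_eq (is_derive1_comp (is_derive_expR _) dl)).
  by rewrite mulrC.
pose G s := k * s + u s + ln (b + z s / W s).
have dG (s : R) : Num.max a 0 <= s ->
    is_derive s 1 G ((k - n) * z s / (W s * (b + z s / W s))).
  rewrite ge_max => /andP[sa s0].
  have bz : 0 < b + z s / W s by have := ha s sa; lra.
  have Wn : W s != 0 by rewrite gt_eqF.
  have dq : is_derive s 1 (fun t => b + z t / W t)
      (- z s * (n + z s) / W s - b * (z s + k)).
    apply: (is_derive_eq (is_deriveD (is_derive_cst b s 1)
                            (is_deriveM (dz s) (is_deriveV Wn (dW s))))).
    by rewrite /GRing.scale /=; field.
  have dl := is_derive1_comp (g := fun t => b + z t / W t)
    (is_derive1_ln bz) dq.
  have dk := is_deriveD (is_deriveZ k (is_derive_id s 1)) (du s).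
  apply: (is_derive_eq (is_deriveD dk dl)).
  rewrite /GRing.scale /=; field.
  rewrite Wn (_ : b * W s + z s = W s * (b + z s / W s)); last by field.
  by rewrite mulf_neq0 ?gt_eqF.
have [l hl] : exists l : R, G s @[s --> +oo] --> l.
  apply: (cvg_of_integrable_derive (C := `|k - n| * (M / c) * (2 / b)) e0 dG).
  move=> s; rewrite ge_max => /andP[sa s0].
  have bz : b / 2 < b + z s / W s by have := ha s sa; lra.
  have bz0 : 0 < b + z s / W s by lra.
  have -> : (k - n) * z s / (W s * (b + z s / W s)) =
      (k - n) * (z s / W s) / (b + z s / W s).
    rewrite invfM; ring.
  rewrite normrM normfV (gtr0_norm bz0) normrM.
  have -> : `|k - n| * (M / c) * (2 / b) * expR (- (e * s)) =
      `|k - n| * (M / c * expR (- (e * s))) * (2 / b) by ring.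
  rewrite ler_pM ?mulr_ge0 ?invr_ge0 ?(ltW bz0)//.
    by rewrite ler_wpM2l// zW.
  by rewrite -[2 / b]invrK invf_div lef_pV2 ?posrE ?divr_gt0// ltW.
exists (l - ln b).
have lb : ln (b + z s / W s) @[s --> +oo] --> ln b.
  rewrite -[in X in _ --> X](addr0 b).
  apply: (@cvg_comp _ _ _ (fun s => b + z s / W s) (@ln R) +oo
                    (nbhs (b + 0)) _).
    exact: cvgD (cvg_cst b) zW0.
  by apply: continuous_ln; rewrite addr0.
apply: cvg_trans (cvgB hl lb).
apply: near_eq_cvg; apply: nearW => s.
by rewrite -[LHS]/(k * s + u s + ln (b + z s / W s) - ln (b + z s / W s)) addrK.
Unshelve. all: by end_near. Qed.

End LogarithmicFlow.

(** * Radial functions along the first axis *)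

(** Turns directional derivatives into one-variable ones, for which the chain
rule is available. *)
Lemma is_derive_line (R : realType) (V W : normedModType R) (f : V -> W)
    (x e : V) (t : R) (d : W) :
  is_derive t 1 (fun s => f (x + s *: e)) d <-> is_derive (x + t *: e) e f d.
Proof.
pose y := x + t *: e.
have E : (fun h : R => h^-1 *:
           (((fun s => f (x + s *: e)) \o shift t) (h *: 1) - f y))
       = (fun h => h^-1 *: ((f \o shift y) (h *: e) - f y)).
  apply/funext => h; congr (_ *: (f _ - _)).
  by rewrite /= [h *: 1]mulr1 scalerDl /y addrCA.
by split=> -[D L]; split; rewrite /derivable /derive ?E// -?E.
Qed.

Section RadialLaplacian.
Context {R : realType} {N : nat}.
Local Notation e0 := (delta_mx 0 0 : 'rV[R]_N.+1).

Lemma enorm_orthogonal (r t : R) (i : 'I_N.+1) : i != 0 ->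
  enorm (r *: e0 + t *: delta_mx 0 i) = Num.sqrt (r ^+ 2 + t ^+ 2).
Proof.
move=> i0; rewrite /enorm /dot; congr Num.sqrt.
rewrite (bigD1 0)//= (bigD1 i)//= big1 => [|j /andP[j0 ji]].
  rewrite !mxE !eqxx /= (negbTE i0) eq_sym (negbTE i0) /=; ring.
by rewrite !mxE !eqxx /= (negbTE j0) (negbTE ji) /=; ring.
Qed.

Lemma enorm_axis (r : R) : enorm (r *: e0) = `|r|.
Proof.
rewrite /enorm /dot (bigD1 0)//= big1 => [|j j0].
  by rewrite !mxE !eqxx /= mulr1 addr0 -expr2 sqrtr_sqr.
by rewrite !mxE !eqxx /= (negbTE j0) /= mulr0 mul0r.
Qed.

Lemma radial_axis (w : 'rV[R]_N.+1 -> R) : radial w ->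
  forall x, w x = w (enorm x *: e0).
Proof.
by move=> wr x; apply: wr; rewrite enorm_axis ger0_norm// /enorm sqrtr_ge0.
Qed.

(** On the line [r e_0 + t e_i] with [i <> 0] the first derivative is
[dw (rho t) * (t / rho t)], where [rho t = sqrt (r^2 + t^2)]. At [t = 0] only
the derivative of the factor [t] survives, so each of the [N] transversal
directions contributes [dw r / r]. *)
Lemma laplacian_radial (w : 'rV[R]_N.+1 -> R) (dw : R -> R) (ddw r : R) :
  radial w -> (forall s : R, is_derive s 1 (fun s => w (s *: e0)) (dw s)) ->
  is_derive r 1 dw ddw -> 0 < r ->
  laplacian w (r *: e0) = ddw + N%:R * (dw r / r).
Proof.
move=> wr wd wdd r0; rewrite /laplacian big_ord_recl; congr (_ + _).
  have pE : (fun s : R => partial 0 w (0 + s *: e0)) = dw.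
    apply/funext => s; rewrite /partial; apply: derive_val.
    by apply/is_derive_line; under eq_fun do rewrite add0r.
  rewrite -[r *: _]add0r /partial; apply: derive_val.
  by apply/is_derive_line; rewrite pE.
rewrite (eq_bigr (fun=> dw r / r)).
  by rewrite big_const_ord iter_addr addr0 mulr_natl.
move=> j _; set i := lift _ _.
have i0 : i != 0 by [].
pose rho (t : R) := Num.sqrt (r ^+ 2 + t ^+ 2).
have rho_gt0 t : 0 < rho t by rewrite sqrtr_gt0 ltr_pwDl ?exprn_gt0 ?sqr_ge0.
have rho0 : rho 0 = r by rewrite /rho expr0n addr0 sqrtr_sqr gtr0_norm.
have drho (t : R) : is_derive t 1 rho (t / rho t).
  have q0 : 0 < r ^+ 2 + t ^+ 2 by rewrite ltr_pwDl ?exprn_gt0 ?sqr_ge0.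
  have dq : is_derive t 1 (fun t => r ^+ 2 + t ^+ 2) (2 * t).
    apply: (is_derive_eq (is_deriveD (is_derive_cst (r ^+ 2) t 1)
                                     (is_deriveX 2 (is_derive_id t 1)))).
    by rewrite /GRing.scale /=; ring.
  apply: (is_derive_eq (is_derive1_comp (g := fun t => r ^+ 2 + t ^+ 2)
                                        (is_derive1_sqrt q0) dq)).
  by rewrite -/(rho t); field; rewrite gt_eqF.
have wE : (fun t : R => w (r *: e0 + t *: delta_mx 0 i)) =
          (fun s => w (s *: e0)) \o rho.
  by apply/funext => t; rewrite radial_axis// enorm_orthogonal.
have pE : (fun t : R => partial i w (r *: e0 + t *: delta_mx 0 i)) =
          (fun t => dw (rho t) * (t / rho t)).
  apply/funext => t; rewrite /partial; apply: derive_val.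
  apply/is_derive_line; rewrite wE.
  exact: is_derive1_comp.
rewrite -[X in partial _ _ X](addr0 _) -[X in _ + X](scale0r (delta_mx 0 i)).
rewrite {1}/partial; apply: derive_val; apply/is_derive_line; rewrite pE.
have rn0 : rho 0 != 0 by rewrite gt_eqF.
have dwr : is_derive (rho 0) 1 dw ddw by rewrite rho0.
have := is_deriveM (is_derive1_comp dwr (drho 0))
   (is_deriveM (is_derive_id (0 : R) 1) (is_deriveV rn0 (drho 0))).
move/is_derive_eq; apply.
by rewrite /GRing.scale /= rho0; field; rewrite gt_eqF.
Qed.

End RadialLaplacian.

(** * From the elliptic equation to the logarithmic system *)

Section RadialProfile.
Context {R : realType} {N : nat} (m alpha beta : R) (v : 'rV[R]_N.+1 -> R).
Hypothesis v_sol : classical_positive_solution m alpha beta v.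
Hypothesis v_rad : radial v.
Hypotheses (m0 : 0 < m) (N0 : (0 < N)%N).
Local Notation e0 := (delta_mx 0 0 : 'rV[R]_N.+1).

Let phi (r : R) := v (r *: e0).
Let dphi (r : R) := partial 0 v (r *: e0).
Let ddphi (r : R) := partial 0 (partial 0 v) (r *: e0).

Lemma profile_gt0 r : 0 < phi r.
Proof. by case: v_sol => _ vp _; exact: vp. Qed.

Lemma is_derive_profile (r : R) : is_derive r 1 phi (dphi r).
Proof.
case: v_sol => -[_ /(_ 0)[vd _]] _ _.
have : is_derive (0 + r *: e0) e0 v (dphi r) by rewrite add0r; exact/derivableP.
by move=> /is_derive_line; under eq_fun do rewrite add0r.
Qed.

Lemma is_derive_profile2 (r : R) : is_derive r 1 dphi (ddphi r).
Proof.
case: v_sol => -[_ /(_ 0)[_ [_ /(_ 0)[vd _]]]] _ _.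
have : is_derive (0 + r *: e0) e0 (partial 0 v) (ddphi r).
  by rewrite add0r; exact/derivableP.
by move=> /is_derive_line; under eq_fun do rewrite add0r.
Qed.

(** The equation on the first axis is divided by [phi^(m-1)], so that the second
derivative gets a constant coefficient and the nonlinearity is concentrated in
the factor [phi^(1-m)] of the lower order terms. *)
Lemma profile_ode r : 0 < r ->
  N%:R * (ddphi r + (m - 1) * (dphi r ^+ 2 / phi r) + N%:R * (dphi r / r))
  + (alpha * phi r + beta * (r * dphi r)) * phi r `^ (1 - m) = 0.
Proof.
move=> r0.
have N00 : (N%:R : R) != 0 by rewrite pnatr_eq0 -lt0n.
have p0 s : phi s != 0 by rewrite gt_eqF// profile_gt0.
have pw s : phi s `^ (m - 1) = (phi s `^ (1 - m))^-1 by rewrite -powRN opprB.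
have pw2 s : phi s `^ (m - 1 - 1) = phi s `^ (m - 1) / phi s.
  by rewrite powRD ?p0 ?implybT// powR_inv1// ltW// profile_gt0.
have dpow a (s : R) : is_derive s 1 (fun s => phi s `^ a)
    (a * phi s `^ (a - 1) * dphi s).
  exact: (is_derive1_comp (f := fun x => x `^ a)
    (is_derive1_powR a (profile_gt0 s)) (is_derive_profile s)).
have dd : is_derive r 1 (fun s => m * phi s `^ (m - 1) * dphi s)
   (m * phi r `^ (m - 1) * (ddphi r + (m - 1) * (dphi r ^+ 2 / phi r))).
  apply: (is_derive_eq (is_deriveM (is_deriveZ m (dpow (m - 1) r))
                                   (is_derive_profile2 r))).
  rewrite -[LHS]/(m * phi r `^ (m - 1) * ddphi r
    + dphi r * (m * ((m - 1) * phi r `^ (m - 1 - 1) * dphi r))) pw2.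
  by field; exact: p0.
have wr : radial (fun y => v y `^ m) by move=> x y xy; rewrite (v_rad xy).
have L := laplacian_radial wr (dpow m) dd r0.
case: v_sol => _ _ /(_ (r *: e0)); rewrite L.
have -> : dot (r *: e0) (grad v (r *: e0)) = r * dphi r.
  rewrite /dot (bigD1 0)//= big1 => [|j j0].
    by rewrite !mxE !eqxx mulr1 addr0.
  by rewrite !mxE !eqxx /= (negbTE j0) mulr0 mul0r.
rewrite -/(phi r) -natr1 addrK pw => eq0.
have q0 : phi r `^ (1 - m) != 0 by rewrite gt_eqF// powR_gt0// profile_gt0.
rewrite -[RHS](mul0r (phi r `^ (1 - m))) -eq0.
by field; rewrite ?q0 ?N00 ?p0 ?(gt_eqF m0) ?(gt_eqF r0).
Qed.

Let u s := ln (phi (expR s)).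
Let z s := expR s * dphi (expR s) / phi (expR s).

Lemma is_derive_profile_expR (s : R) :
  is_derive s 1 (phi \o expR) (dphi (expR s) * expR s).
Proof. exact: is_derive1_comp (is_derive_profile _) (is_derive_expR s). Qed.

Lemma is_derive_log_profile (s : R) : is_derive s 1 u (z s).
Proof.
apply: (is_derive_eq (is_derive1_comp (g := phi \o expR)
  (is_derive1_ln (profile_gt0 _)) (is_derive_profile_expR s))).
by rewrite mulrC [_ * expR s]mulrC.
Qed.

Lemma is_derive_log_slope (s : R) : beta != 0 ->
  is_derive s 1 z (- z s * (N.+1%:R - 2 + m * z s)
    - beta / N%:R * expR (2 * s + (1 - m) * u s) * (z s + alpha / beta)).
Proof.
move=> beta0.
have r0 : 0 < expR s := expR_gt0 s.
have pn : phi (expR s) != 0 by rewrite gt_eqF// profile_gt0.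
have N00 : (N%:R : R) != 0 by rewrite pnatr_eq0 -lt0n.
have dr := is_deriveM (is_derive_expR s)
  (is_derive1_comp (is_derive_profile2 _) (is_derive_expR s)).
apply: (is_derive_eq (is_deriveM dr (is_deriveV (f := phi \o expR) pn
  (is_derive_profile_expR s)))).
have ode := profile_ode r0.
have -> : expR (2 * s + (1 - m) * u s) = expR s ^+ 2 * phi (expR s) `^ (1 - m).
  by rewrite expRD /powR (negbTE pn) expRM_natl.
have dd : ddphi (expR s) = - ((m - 1) * (dphi (expR s) ^+ 2 / phi (expR s)))
   - N%:R * (dphi (expR s) / expR s)
   - (alpha * phi (expR s) + beta * (expR s * dphi (expR s)))
     * phi (expR s) `^ (1 - m) / N%:R.
  apply: (mulfI N00); apply/eqP; rewrite -subr_eq0; apply/eqP.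
  by rewrite -[RHS]ode; field; rewrite ?N00 ?pn ?(gt_eqF r0).
rewrite -[LHS]/(expR s * dphi (expR s)
    * (- phi (expR s) ^- 2 * (dphi (expR s) * expR s))
  + (phi (expR s))^-1 * (expR s * (ddphi (expR s) * expR s)
                         + dphi (expR s) * expR s)).
rewrite dd /z -natr1; field.
by rewrite ?N00 ?pn ?beta0 ?(gt_eqF r0).
Qed.

(** As a function of [r = e^s] the slope is [r phi'(r) / phi(r)], which is
continuous at [r = 0] and vanishes there. *)
Lemma log_slope_cvg0 : z s @[s --> -oo] --> 0.
Proof.
have expR0 : expR s @[s --> -oo] --> (0 : R).
  by apply/cvgNy_compNP; exact: cvgr_expR.
have h : (fun r => r * dphi r / phi r) r @[r --> (0:R)] --> 0 * dphi 0 / phi 0.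
  have cts (f df : R -> R) :
      (forall s : R, is_derive s 1 f (df s)) -> {for 0, continuous f}.
    move=> fd; apply: differentiable_continuous; apply/derivable1_diffP.
    exact: ex_derive.
  apply: cvgM; first apply: cvgM.
  - exact: cvg_id.
  - exact: cts is_derive_profile2.
  - apply: cvgV; first by rewrite gt_eqF// profile_gt0.
    exact: cts is_derive_profile.
rewrite mul0r mul0r in h.
exact: cvg_comp expR0 h.
Qed.

End RadialProfile.

Lemma cvg_ln_enorm (R : realType) (n : nat) :
  ln (enorm x) @[x --> infty_nbhs R n] --> +oo.
Proof.
apply/cvgryPgt => A; exists (expR A) => x Ax.
by rewrite -ltr_expR lnK// posrE (lt_trans (expR_gt0 A) Ax).
Qed.

Theorem theorem3p1 (R : realType) (n : nat) (m eta alpha beta : R)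
    (v : 'rV[R]_n -> R) :
  (3 <= n)%N ->
  0 < m -> m < (n%:R - 2) / n%:R ->
  0 < eta ->
  Num.max alpha 0 < 2 * beta / (1 - m) ->
  classical_positive_solution m alpha beta v ->
  radial v ->
  v 0 = eta ->
  exists A : R,
    0 < A /\
    enorm x `^ (alpha / beta) * v x @[x --> infty_nbhs R n] --> A.
Proof.
case: n v => [//|N] v N2 m0 mN _ ab vsol vrad _.
have N0 : (0 < N)%N := @ltnW 1 N N2.
have Nr : 0 < N%:R :> R by rewrite ltr0n.
have mn : m * N.+1%:R < N.+1%:R - 2 by rewrite -ltr_pdivlMr// ltr0n.
have m1 : m < 1.
  rewrite -(ltr_pM2r (_ : 0 < N.+1%:R)) ?ltr0n// mul1r.
  by apply: lt_trans mn _; lra.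
have m1' : 0 < 1 - m by lra.
move: ab; rewrite gt_max => /andP[ab b0].
have beta0 : 0 < beta.
  by move: b0; rewrite pmulr_lgt0 ?invr_gt0// pmulr_rgt0.
have km : alpha / beta * (1 - m) < 2.
  by rewrite mulrAC ltr_pdivrMr// -ltr_pdivlMr.
have bN : 0 < beta / N%:R by rewrite divr_gt0.
have beta_n0 : beta != 0 by rewrite gt_eqF.
have [l hl] := log_flow_cvg (is_derive_log_profile vsol)
  (fun s => is_derive_log_slope vsol vrad m0 N0 s beta_n0) (log_slope_cvg0 vsol)
  m0 m1 mn bN km.
exists (expR l); split; first exact: expR_gt0.
have hexp : expR (alpha / beta * s + ln (v (expR s *: delta_mx 0 0)))
    @[s --> +oo] --> expR l.
  by apply: continuous_cvg => //; exact: continuous_expR.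
have := cvg_comp _ _ (@cvg_ln_enorm R N.+1) hexp.
apply: cvg_trans; apply: near_eq_cvg; exists 0 => x x0.
have xn : enorm x != 0 by rewrite gt_eqF.
have vx : 0 < v (enorm x *: delta_mx 0 0) by case: vsol => _ vp _; exact: vp.
rewrite (radial_axis vrad x) /powR (negbTE xn).
by rewrite /comp (lnK x0) expRD lnK.
Qed.
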